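(* Assume that $q_i^x$, $q_j^{y,i}$ and $q_k^{z,i,j}$ all have property (D), and let $j,k\ge1$. For $i\ge2$ let $$w^{\blacktriangle,I}_{ijk}=i\,f_i\,\nabla g_{i,j}\times\nabla h_{i,j,k}-j\,g_{i,j}\,\nabla f_i\times\nabla h_{i,j,k}+k\,h_{i,j,k}\,\nabla f_i\times\nabla g_{i,j},$$ and for $i=1$ let $$w^{\blacktriangle,I}_{1jk}=(j+2)\,g_{1,j}\,\bigl(\nabla h_{1,j,k}\times v^{\mathcal N_0}_{[1,2]}\bigr)-k\,h_{1,j,k}\,\bigl(\nabla g_{1,j}\times v^{\mathcal N_0}_{[1,2]}\bigr)-k\,g_{1,j}h_{1,j,k}\,\mathrm{curl}\,v^{\mathcal N_0}_{[1,2]}.$$ Then $w^{\blacktriangle,I}_{ijk}\in\mathcal{RT}_{i+j+k-2}$ for $i\ge2$, and $w^{\blacktriangle,I}_{1jk}\in\mathcal{RT}_{j+k}$. More precisely, $w^{\blacktriangle,I}_{ijk}=p_1(x,y,z)\,\vec r+\vec p_2(x,y,z)$, where, with $\chi=\frac{2y}{1-z}$ and $\eta=\frac{4x}{1-2y-z}$: for $i\ge2$, $$p_1=(q_i^x)'(\eta)\left(\tfrac{1-2y-z}{4}\right)^{i-1}(q_j^{y,i})'(\chi)\left(\tfrac{1-z}{2}\right)^{j-1}(q_k^{z,i,j})'(z)\in\mathcal P_{i+j+k-3},\qquad \vec p_2\in[\mathcal P_{i+j+k-3}]^3;$$ for $i=1$, $$p_1=\left(\tfrac{1-z}{2}\right)^{j-1}\tfrac18\,(q_k^{z,1,j})'(z)\Bigl((2y+z)(q_j^{y,1})'(\chi)+2(1-z)\,q_j^{y,1}(\chi)\Bigr)\in\mathcal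 P_{j+k-1},\qquad \vec p_2\in[\mathcal P_{j+k-1}]^3.$$
   Context: $\mathcal P_m$ is the space of real polynomials of total degree at most $m$; $\vec r=(x,y,z)^\top$. The Raviart–Thomas space is $\mathcal{RT}_m=\vec r\,\mathcal P_{m-1}+[\mathcal P_{m-1}]^3$. Univariate polynomial families: $q_i^x$ of exact degree $i$ ($i\ge2$) with $q_i^x(\pm1)=0$; $q_j^{y,i}$ of exact degree $j$ ($i,j\ge1$) with $q_j^{y,i}(-1)=0$; $q_k^{z,i,j}$ of exact degree $k$ ($i,j,k\ge1$) with $q_k^{z,i,j}(-1)=0$. A polynomial $q$ of degree $n$ has property (D) if $\chi q'(\chi)-n\,q(\chi)$ is a polynomial of degree at most $n-1$ in $\chi$. Auxiliary functions (polynomials in $x,y,z$): $f_i=q_i^x\!\left(\frac{4x}{1-2y-z}\right)\left(\frac{1-2y-z}{4}\right)^i$, $g_{i,j}=q_j^{y,i}\!\left(\frac{2y}{1-z}\right)\left(\frac{1-z}{2}\right)^j$, $h_{i,j,k}=q_k^{z,i,j}(z)$. The lowest order Nédélec function is $v^{\mathcal N_0}_{[1,2]}=-\tfrac18(1-2y-z,\,2x,\,x)^\top$. *)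

(* Defs.v *)
From HB Require Import structures.
From mathcomp Require Import all_boot all_order all_algebra.
From mathcomp Require Import mpoly.

Set Implicit Arguments.
Unset Strict Implicit.
Unset Printing Implicit Defensive.

Import Order.TTheory GRing.Theory Num.Theory.
Local Open Scope ring_scope.

Notation "p %:F" := (@FracField.tofrac _ p) : ring_scope.

Section Vectors.
Variable A : comNzRingType.

Definition vec3 (a b c : A) : 'cV[A]_3 := \col_i [:: a; b; c]`_i.

Definition cross (u v : 'cV[A]_3) : 'cV[A]_3 :=
  vec3 (u 1 0 * v 2%:R 0 - u 2%:R 0 * v 1 0)
       (u 2%:R 0 * v 0 0 - u 0 0 * v 2%:R 0)
       (u 0 0 * v 1 0 - u 1 0 * v 0 0).
End Vectors.

Section RaviartThomas.
Variable R : realFieldType.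

Definition cx : {mpoly R[3]} := 'X_0.
Definition cy : {mpoly R[3]} := 'X_1.
Definition cz : {mpoly R[3]} := 'X_(2%:R).

Definition rvec : 'cV[{mpoly R[3]}]_3 := vec3 cx cy cz.

Definition grad (p : {mpoly R[3]}) : 'cV[{mpoly R[3]}]_3 := \col_i p^`M(i).

Definition curl (u : 'cV[{mpoly R[3]}]_3) : 'cV[{mpoly R[3]}]_3 :=
  vec3 ((u 2%:R 0)^`M(1) - (u 1 0)^`M(2%:R))
       ((u 0 0)^`M(2%:R) - (u 2%:R 0)^`M(0))
       ((u 1 0)^`M(0) - (u 0 0)^`M(1)).

(* [msize p] is the total degree plus one, and is 0 for [p = 0]. *)
Definition inP (m : nat) (p : {mpoly R[3]}) : Prop := (msize p <= m.+1)%N.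

Definition inP3 (m : nat) (u : 'cV[{mpoly R[3]}]_3) : Prop :=
  forall i : 'I_3, inP m (u i 0).

(* Meant for [0 < m] only, because of the truncated predecessor. *)
Definition inRT (m : nat) (w : 'cV[{mpoly R[3]}]_3) : Prop :=
  exists (p : {mpoly R[3]}) (q : 'cV[{mpoly R[3]}]_3),
    [/\ inP m.-1 p, inP3 m.-1 q & w = p *: rvec + q].

Definition exact_degree (n : nat) (q : {poly R}) : Prop := size q = n.+1.

Definition propD (n : nat) (q : {poly R}) : Prop :=
  (size ('X * q^`() - n%:R *: q)%R <= n)%N.

Definition nedelec12 : 'cV[{mpoly R[3]}]_3 :=
  (- (8^-1)%:MP) *: vec3 (1 - 2 * cy - cz) (2 * cx) cx.

(* Formulas with a quotient of polynomials as argument are read in the field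
   of rational functions R(x,y,z). *)
Local Notation RF := {fraction {mpoly R[3]}}.

Definition evalF (q : {poly R}) (a : RF) : RF :=
  (map_poly (fun c : R => (c%:MP_[3])%:F : RF) q).[a].

Definition xF : RF := cx%:F.
Definition yF : RF := cy%:F.
Definition zF : RF := cz%:F.

Definition eta : RF := 4 * xF / (1 - 2 * yF - zF).
Definition chi : RF := 2 * yF / (1 - zF).

Definition f_rat (qx : nat -> {poly R}) (i : nat) : RF :=
  evalF (qx i) eta * ((1 - 2 * yF - zF) / 4) ^+ i.

Definition g_rat (qy : nat -> nat -> {poly R}) (i j : nat) : RF :=
  evalF (qy i j) chi * ((1 - zF) / 2) ^+ j.

Definition h_aux (qz : nat -> nat -> nat -> {poly R}) (i j k : nat) :
  {mpoly R[3]} := (map_poly (@mpolyC 3 R) (qz i j k)).[cz].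

Definition w_ge2 (i j k : nat) (f g h : {mpoly R[3]}) : 'cV[{mpoly R[3]}]_3 :=
  (i%:R * f) *: cross (grad g) (grad h)
  - (j%:R * g) *: cross (grad f) (grad h)
  + (k%:R * h) *: cross (grad f) (grad g).

Definition w_one (j k : nat) (g h : {mpoly R[3]}) : 'cV[{mpoly R[3]}]_3 :=
  ((j + 2)%:R * g) *: cross (grad h) nedelec12
  - (k%:R * h) *: cross (grad g) nedelec12
  - (k%:R * g * h) *: curl nedelec12.

(* [f_rat qx i] and [g_rat qy i j] are polynomials, so an equation
   [p%:F = f_rat qx i] determines a (unique) polynomial [p]. *)

Lemma homogenize_ex (q : {poly R}) (n : nat) (u v : {mpoly R[3]}) :
  (size q <= n.+1)%N -> v != 0 ->
  exists p : {mpoly R[3]}, p%:F = evalF q (u%:F / v%:F) * v%:F ^+ n.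
Proof.
move=> sq v0.
exists (\sum_(l < n.+1) (q`_l)%:MP * u ^+ l * v ^+ (n - l)).
have v0F : v%:F != 0 :> RF by rewrite tofrac_eq0.
rewrite /evalF map_polyE (@horner_coef_wide _ n.+1); last first.
  by apply: leq_trans (size_Poly _) _; rewrite size_map.
rewrite mulr_suml rmorph_sum; apply: eq_bigr => l _ /=.
rewrite coef_Poly !tofracM !tofracXn expr_div_n.
have -> : [seq ((c%:MP_[3])%:F : RF) | c <- q]`_l = ((q`_l)%:MP_[3])%:F.
  have [ql|ql] := ltnP l (size q); first by rewrite (nth_map 0).
  by rewrite !nth_default ?size_map // mpolyC0 tofrac0.
rewrite -!mulrA; congr (_ * (_ * _)).
have -> : v%:F ^+ n = v%:F ^+ l * v%:F ^+ (n - l) :> RF.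
  by rewrite -exprD subnKC // -ltnS.
by rewrite mulKf // expf_neq0.
Qed.

Lemma scaled_homogenize_ex (q : {poly R}) (n m : nat) (u d : {mpoly R[3]}) :
  (size q <= n.+1)%N -> d != 0 ->
  exists p : {mpoly R[3]},
    p%:F = evalF q (m.+1%:R * u%:F / d%:F) * (d%:F / m.+1%:R) ^+ n.
Proof.
move=> sq d0; pose v := d * ((m.+1%:R)^-1)%:MP.
have m0 : (m.+1%:R : R) != 0 by rewrite pnatr_eq0.
have v0 : v != 0 by rewrite mulf_neq0 // mpolyC_eq0 invr_neq0.
have mF : (m.+1%:R : RF) = ((m.+1%:R)%:MP_[3])%:F by rewrite mpolyC_nat rmorph_nat.
have m0F : (m.+1%:R : RF) != 0 by rewrite mF tofrac_eq0 mpolyC_eq0.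
have vF : v%:F = d%:F / m.+1%:R :> RF.
  apply: (mulIf m0F); rewrite divfK // {1}mF -tofracM /v -mulrA -mpolyCM.
  by rewrite mulVf // mpolyC1 mulr1.
have [p Ep] := @homogenize_ex q n u v sq v0; exists p.
by rewrite Ep vF invf_div mulrA [u%:F * _]mulrC.
Qed.

Lemma f_rat_poly (qx : nat -> {poly R}) (i : nat) :
  exact_degree i (qx i) -> exists f : {mpoly R[3]}, f%:F = f_rat qx i.
Proof.
move=> sq; have d0 : 1 - 2 * cy - cz != 0.
  apply/eqP=> /(congr1 (meval (fun=> 0))).
  rewrite !mevalB mevalM !mevalXU meval1 meval0 mulr0 !subr0.
  by apply/eqP/oner_neq0.
have [|p Ep] := @scaled_homogenize_ex (qx i) i 3 cx _ _ d0; first by rewrite sq.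
by exists p; rewrite Ep !tofracB tofracM tofrac1 rmorph_nat.
Qed.

Lemma g_rat_poly (qy : nat -> nat -> {poly R}) (i j : nat) :
  exact_degree j (qy i j) -> exists g : {mpoly R[3]}, g%:F = g_rat qy i j.
Proof.
move=> sq; have d0 : 1 - cz != 0.
  apply/eqP=> /(congr1 (meval (fun=> 0))).
  by rewrite mevalB mevalXU meval1 meval0 subr0; apply/eqP/oner_neq0.
have [|p Ep] := @scaled_homogenize_ex (qy i j) j 1 cy _ _ d0; first by rewrite sq.
by exists p; rewrite Ep tofracB tofrac1.
Qed.

End RaviartThomas.

Arguments cx {R}.
Arguments cy {R}.
Arguments cz {R}.
Arguments rvec {R}.
Arguments nedelec12 {R}.
Arguments xF {R}.
Arguments yF {R}.
Arguments zF {R}.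
Arguments eta {R}.
Arguments chi {R}.

(* Main.v *)
(* Each auxiliary function p of degree n is the homogenization of a univariate
   polynomial in two affine forms u and v, so Euler's identity
   n p = u d_u p + v d_v p reads n p = r . grad p + b, where b has degree < n and
   is the contribution of the constant terms of u and v (for h take v = 1).
   Substituting these into w and using
   (r.a) b x c - (r.b) a x c + (r.c) a x b = det (a, b, c) r
   leaves det (grad f, grad g, grad h) r plus terms of lower degree, and this
   determinant is triangular.  For i = 1 the same substitutions cancel every term
   of top degree except p1 r. *)

Require Import Defs.
From mathcomp Require Import all_boot all_order all_algebra.
From mathcomp Require Import ring zify.
From mathcomp Require Import mpoly.

Set Implicit Arguments.
Unset Strict Implicit.
Unset Printing Implicit Defensive.

Import Order.TTheory GRing.Theory Num.Theory.
Local Open Scope ring_scope.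

(** * Vector algebra in dimension three *)

Lemma ord3_ind (P : 'I_3 -> Prop) : P 0 -> P 1 -> P 2%:R -> forall i, P i.
Proof.
move=> P0 P1 P2 [[|[|[|//]]] lt3].
- by rewrite (_ : Ordinal lt3 = 0) //; apply/val_inj.
- by rewrite (_ : Ordinal lt3 = 1) //; apply/val_inj.
- by rewrite (_ : Ordinal lt3 = 2%:R) //; apply/val_inj.
Qed.

Section Vec3.
Variable A : comNzRingType.
Implicit Types u v w r : 'cV[A]_3.

Lemma vec3_0 (a b c : A) : vec3 a b c 0 0 = a. Proof. by rewrite mxE. Qed.
Lemma vec3_1 (a b c : A) : vec3 a b c 1 0 = b. Proof. by rewrite mxE. Qed.
Lemma vec3_2 (a b c : A) : vec3 a b c 2%:R 0 = c. Proof. by rewrite mxE. Qed.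
Lemma colD u v i : (u + v) i 0 = u i 0 + v i 0. Proof. by rewrite mxE. Qed.
Lemma colN u i : (- u) i 0 = - u i 0. Proof. by rewrite mxE. Qed.
Lemma colZ a u i : (a *: u) i 0 = a * u i 0. Proof. by rewrite mxE. Qed.
Definition vec3E := (colD, colN, colZ, vec3_0, vec3_1, vec3_2).

Lemma col3P u v : u 0 0 = v 0 0 -> u 1 0 = v 1 0 ->
  u 2%:R 0 = v 2%:R 0 -> u = v.
Proof. by move=> ? ? ?; apply/matrixP=> i j; rewrite ord1; elim/ord3_ind: i. Qed.

Lemma vec3Z a b c d : a *: vec3 b c d = vec3 (a * b) (a * c) (a * d) :> 'cV[A]_3.
Proof. by apply: col3P; rewrite !vec3E. Qed.

Definition dot u v : A := u 0 0 * v 0 0 + u 1 0 * v 1 0 + u 2%:R 0 * v 2%:R 0.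

(** Cramer's rule: up to the factor det (u, v, w), the three cross products form the basis dual to
    [u], [v], [w], so they rebuild [r] from its dot products. *)
Lemma dot_cross_decomposition r u v w :
  dot r u *: cross v w - dot r v *: cross u w + dot r w *: cross u v
    = dot u (cross v w) *: r.
Proof. by apply: col3P; rewrite /dot /cross !vec3E; ring. Qed.

(** Here [c] and [- bg] stand for the derivatives of g in y and z, [d] for that of h in z, and
    [z * d + bh] for k h. For [e] = 1/8, [v] is the Nédélec function and [e *: vec3 0 2 (- 4)] its
    curl. The hypothesis is Euler's identity for g; it cancels the excess terms of top degree in the
    first two components, while the third follows by plain expansion. *)
Lemma w_one_cross_identity (J x y z c d g bg bh e : A) :
  J * g = y * c - z * bg + bg ->
  let v := - e *: vec3 (1 - 2 * y - z) (2 * x) x in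
  ((J + 2) * g) *: cross (vec3 0 0 d) v - (z * d + bh) *: cross (vec3 0 c (- bg)) v
    - ((z * d + bh) * g) *: (e *: vec3 0 2 (- 4))
  = (e * d * ((2 * y + z) * c + 4 * g)) *: vec3 x y z
    + e *: vec3
        (x * d * 2 * bg + bh * x * (c + 2 * bg))
        (d * (2 * y + z) * bg - (J + 2) * g * d - z * d * bg - bh * bg
           + bh * bg * (2 * y + z) - 2 * g * bh)
        (4 * g * bh - z * d * c - bh * c * (1 - 2 * y - z)).
Proof. by move=> Jg; apply: col3P; rewrite /cross !vec3E; ring: Jg. Qed.

End Vec3.

(** * Degree bounds and derivatives of trivariate polynomials *)

Section Polynomials.
Variable R : realFieldType.
Implicit Types (p u v : {mpoly R[3]}) (q : {poly R}).
Local Notation RF := {fraction {mpoly R[3]}}.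

Lemma inP_leq m n p : (m <= n)%N -> inP m p -> inP n p.
Proof. by rewrite /inP => mn /leq_trans; apply. Qed.

Lemma inPD n p p' : inP n p -> inP n p' -> inP n (p + p').
Proof.
by move=> Pp Pp'; apply: leq_trans (msizeD_le _ _) _; rewrite geq_max; apply/andP.
Qed.

Lemma inP_maxD m n p p' : inP m p -> inP n p' -> inP (maxn m n) (p + p').
Proof.
by move=> Pp Pp'; apply: inPD; [apply: inP_leq Pp | apply: inP_leq Pp'];
  rewrite ?leq_maxl ?leq_maxr.
Qed.

Lemma inPN n p : inP n p -> inP n (- p).
Proof. by rewrite /inP msizeN. Qed.

Lemma inPB n p p' : inP n p -> inP n p' -> inP n (p - p').
Proof. by move=> Pp Pp'; apply/inPD/inPN. Qed.

Lemma inP0 n : inP n (0 : {mpoly R[3]}).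
Proof. by rewrite /inP msize0. Qed.

Lemma inPC n (c : R) : inP n c%:MP.
Proof. by rewrite /inP msizeC; case: (_ != _). Qed.

Lemma inP_nat n m : inP n (m%:R : {mpoly R[3]}).
Proof. by rewrite -mpolyC_nat; apply: inPC. Qed.

Lemma inPM m n p p' : inP m p -> inP n p' -> inP (m + n) (p * p').
Proof.
have [->|p0] := eqVneq p 0; first by rewrite mul0r => *; apply: inP0.
have [->|p'0] := eqVneq p' 0; first by rewrite mulr0 => *; apply: inP0.
rewrite /inP msizeM //; move: (msize p) (msize p') => a b; lia.
Qed.

Lemma inPX m n p : inP m p -> inP (n * m) (p ^+ n).
Proof.
move=> Pp; elim: n => [|n IHn]; first exact: (inP_nat 0 1).
by rewrite exprS mulSn; apply: inPM.
Qed.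

Lemma inP_sum n I (r : seq I) (F : I -> {mpoly R[3]}) :
  (forall i, inP n (F i)) -> inP n (\sum_(i <- r) F i).
Proof. by move=> PF; elim/big_ind: _ => *; [apply: inP0 | apply: inPD |]. Qed.

Lemma inP_var i : inP 1 ('X_i : {mpoly R[3]}).
Proof. by rewrite /inP msizeX mdeg1. Qed.

Lemma mderivXU i j : ('X_i : {mpoly R[3]})^`M(j) = (i == j)%:R.
Proof.
rewrite mderivX mnm1E; case: eqP => [->|_]; last by rewrite scale0r.
by rewrite scale1r -{1}[U_(j)%MM]add0m addmK mpolyX0.
Qed.

Lemma mderiv_exp j n p : (p ^+ n)^`M(j) = n%:R * p ^+ n.-1 * p^`M(j).
Proof.
elim: n => [|n IHn]; first by rewrite expr0 mul0r mul0r -mpolyC1 mderivC.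
rewrite exprS mderivM IHn; case: n {IHn} => [|n] /=; first by rewrite expr0; ring.
by rewrite exprS; ring.
Qed.

Lemma inP_term n k l c u v : inP 0 c -> inP 1 u -> inP 1 v -> (k + l <= n)%N ->
  inP n (c * u ^+ k * v ^+ l).
Proof.
move=> Pc Pu Pv /inP_leq; apply; rewrite -[X in (X + _)%N]muln1.
rewrite -[X in (_ + X)%N]muln1 -[X in (X + _)%N]add0n.
by apply: inPM (inPX _ Pv); apply: inPM (inPX _ Pu).
Qed.

(** * Homogenization of a univariate polynomial in two affine forms *)

Definition homogenize n q u v : {mpoly R[3]} :=
  \sum_(l < n.+1) (q`_l)%:MP * u ^+ l * v ^+ (n - l).

(** For l <= n the monomial u^l v^(n-l) equals v^n (u/v)^l. The bound on [size q] ensures that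
    cutting the sum at n loses no coefficient. *)
Lemma tofrac_homogenize n q u v : (size q <= n.+1)%N -> v != 0 ->
  (homogenize n q u v)%:F = evalF q (u%:F / v%:F) * v%:F ^+ n.
Proof.
move=> sq v0; have v0F : v%:F != 0 :> RF by rewrite tofrac_eq0.
rewrite /evalF (@horner_coef_wide _ n.+1); last first.
  by apply: leq_trans (size_poly _ _) _.
rewrite mulr_suml rmorph_sum; apply: eq_bigr => l _ /=.
rewrite coef_map_id0 ?mpolyC0 ?tofrac0 // !tofracM !tofracXn expr_div_n.
have -> : v%:F ^+ n = v%:F ^+ l * v%:F ^+ (n - l) :> RF.
  by rewrite -exprD subnKC // -ltnS.
rewrite -!mulrA; congr (_ * (_ * _)).
by rewrite (mulKf (expf_neq0 _ v0F)).
Qed.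

Lemma inP_homogenize n q u v : inP 1 u -> inP 1 v -> inP n (homogenize n q u v).
Proof.
move=> Pu Pv; apply: inP_sum => l; apply: inP_term (inPC _ _) Pu Pv _.
by rewrite subnKC // -ltnS.
Qed.

(* The partial derivatives [a], [b] of the homogenization with respect to its
   two arguments satisfy Euler's identity. *)
Lemma homogenize_gradient n q u v p :
  (size q <= n.+2)%N -> v != 0 -> inP 1 u -> inP 1 v ->
  p%:F = evalF q (u%:F / v%:F) * v%:F ^+ n.+1 ->
  inP n.+1 p /\
  exists a b, [/\ inP n a, inP n b,
    a%:F = evalF q^`() (u%:F / v%:F) * v%:F ^+ n,
    n.+1%:R * p = u * a + v * b &
    forall i, p^`M(i) = a * u^`M(i) + b * v^`M(i)].
Proof.
move=> sq v0 Pu Pv; rewrite -tofrac_homogenize // => /eqP.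
rewrite tofrac_eq => /eqP->; split; first exact: inP_homogenize.
exists (homogenize n q^`() u v).
exists (\sum_(l < n.+1) ((n.+1 - l)%:R * (q`_l)%:MP) * u ^+ l * v ^+ (n - l)).
have sq' : (size q^`() <= n.+1)%N.
  by apply: leq_trans (size_poly _ _) _; rewrite -subn1 leq_subLR.
(* Both partial derivatives are rewritten over the index range of [p], so that the two remaining
   claims can be checked monomial by monomial. The added terms, l = 0 for the first and l = n + 1
   for the second, carry a zero coefficient. *)
have aE : homogenize n q^`() u v =
    \sum_(l < n.+2) l%:R * (q`_l)%:MP * u ^+ l.-1 * v ^+ (n.+1 - l).
  rewrite big_ord_recl /= !mul0r add0r; apply: eq_bigr => l _.
  rewrite coef_deriv /= subSS add0n /bump add1n.
  by rewrite -[X in X%:MP]mulr_natl mpolyCM mpolyC_nat.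
have bE : \sum_(l < n.+1) ((n.+1 - l)%:R * (q`_l)%:MP) * u ^+ l * v ^+ (n - l) =
    \sum_(l < n.+2) (n.+1 - l)%:R * (q`_l)%:MP * u ^+ l * v ^+ (n.+1 - l).-1.
  rewrite [RHS]big_ord_recr /= subnn !mul0r addr0; apply: eq_bigr => l _.
  by rewrite subSn -1?ltnS.
split.
- exact: inP_homogenize.
- apply: inP_sum => l; apply: inP_term Pu Pv _; last by rewrite subnKC // -ltnS.
  by apply: (@inPM 0 0) (inP_nat _ _) (inPC _ _).
- exact: tofrac_homogenize.
- rewrite aE bE !mulr_sumr -big_split; apply: eq_bigr => l _ /=.
  have ln : (l <= n.+1)%N by rewrite -ltnS.
  (* At exponent 0 the truncated predecessor is harmless, since both sides vanish. *)
  have uX : u * (l%:R * u ^+ l.-1) = l%:R * u ^+ l.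
    by case: (l : nat) => [|l']; rewrite ?mul0r ?mulr0 // exprS mulrCA.
  have vX m : v * (m%:R * v ^+ m.-1) = m%:R * v ^+ m.
    by case: m => [|m]; rewrite ?mul0r ?mulr0 // exprS mulrCA.
  (* The total exponent n + 1 splits into l and n + 1 - l, one share for each partial derivative. *)
  transitivity (l%:R * u ^+ l * (q`_l)%:MP * v ^+ (n.+1 - l)
    + (n.+1 - l)%:R * v ^+ (n.+1 - l) * (q`_l)%:MP * u ^+ l).
    rewrite -{1}(subnKC ln) natrD; ring.
  by rewrite -uX -vX; ring.
- move=> i; rewrite aE bE !mulr_suml -big_split raddf_sum.
  apply: eq_bigr => l _ /=.
  by rewrite !mderivM mderivC !mderiv_exp; ring.
Qed.


(** * Gradients and Euler identities of the auxiliary functions *)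

Lemma gradE p i : grad p i 0 = p^`M(i). Proof. by rewrite mxE. Qed.

Lemma mderiv_nat i n : (n%:R : {mpoly R[3]})^`M(i) = 0.
Proof. by rewrite -mpolyC_nat mderivC. Qed.

Lemma mderiv1 i : (1 : {mpoly R[3]})^`M(i) = 0.
Proof. exact: mderiv_nat 1. Qed.

Definition mderivE := (mderivB, mderivD, mderivN, mderivM, mderivXU, mderivC,
  mderiv_nat, mderiv1, eqxx).

Lemma mpolyC_natV n : n.+1%:R * (n.+1%:R^-1)%:MP = 1 :> {mpoly R[3]}.
Proof. by rewrite -mpolyC_nat -mpolyCM mulfV ?mpolyC1 // pnatr_eq0. Qed.

Lemma fraction_nat_neq0 n : n.+1%:R != 0 :> RF.
Proof.
rewrite -(rmorph_nat (@FracField.tofrac _)) -mpolyC_nat.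
by rewrite tofrac_eq0 mpolyC_eq0 pnatr_eq0.
Qed.

Lemma tofrac_natV n : ((n.+1%:R^-1)%:MP_[3])%:F = n.+1%:R^-1 :> RF.
Proof.
apply: (mulfI (fraction_nat_neq0 n)); rewrite mulfV ?fraction_nat_neq0 //.
rewrite -{1}(rmorph_nat (@FracField.tofrac _)).
by rewrite -tofracM mpolyC_natV tofrac1.
Qed.

Lemma simplex_f_gradient n q p : (size q <= n.+2)%N ->
  p%:F = evalF q eta * ((1 - 2 * yF - zF) / 4) ^+ n.+1 ->
  exists a b, [/\ inP n a, inP n b,
    a%:F = evalF q^`() eta * ((1 - 2 * yF - zF) / 4) ^+ n,
    n.+1%:R * p = dot rvec (grad p) + b &
    grad p = vec3 a (- 2 * b) (- b)].
Proof.
move=> sq; pose c4 : {mpoly R[3]} := (4^-1)%:MP.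
pose v := (1 - 2 * cy - cz) * c4.
have vF : v%:F = (1 - 2 * yF - zF) / 4.
  by rewrite tofracM tofrac_natV !tofracB tofracM tofrac1 rmorph_nat.
have v0 : v != 0.
  (* The value of [v] at the origin is 1/4. *)
  apply/eqP=> /(congr1 (meval (fun=> 0))) /eqP.
  rewrite mevalM !mevalB mevalM !mevalXU !mevalC mulr0 !subr0 mul1r.
  by rewrite invr_eq0 pnatr_eq0.
have etaE : eta = cx%:F / v%:F :> RF by rewrite vF invf_div mulrA [cx%:F * _]mulrC.
have Pv : inP 1 v.
  rewrite -[1%N]addn0; apply: inPM (inPC _ _); apply: inPB (inP_var _).
  by apply: inPB; [apply: inP_nat 1 | apply: (@inPM 0 1) (inP_nat _ _) (inP_var _)].
rewrite -vF etaE => Ep.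
have [_ [a [b [Pa Pb aF euler dp]]]] := homogenize_gradient sq v0 (inP_var _) Pv Ep.
(* The gradient of [v] is (0, -1/2, -1/4) and its constant term is 1/4, so a quarter of the
   derivative in [v] serves both as the Euler defect and, up to sign, as the z-derivative. *)
exists a, (c4 * b).
have gradp : grad p = vec3 a (- 2 * (c4 * b)) (- (c4 * b)).
  by apply: col3P; rewrite gradE vec3E dp !mderivE /=; ring.
split=> //; first by apply: (@inPM 0) (inPC _ _) Pb.
by rewrite euler gradp /dot /rvec !vec3E /v /cx /cy /cz; ring.
Qed.

(** The affine forms are y and (1 - z)/2. The bound on [p] itself is recorded because for i = 1 the
    factor g survives undifferentiated in both parts of the decomposition. *)
Lemma simplex_g_gradient n q p : (size q <= n.+2)%N ->
  p%:F = evalF q chi * ((1 - zF) / 2) ^+ n.+1 ->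
  inP n.+1 p /\
  exists a b, [/\ inP n a, inP n b,
    a%:F = evalF q^`() chi * ((1 - zF) / 2) ^+ n,
    n.+1%:R * p = dot rvec (grad p) + b &
    grad p = vec3 0 a (- b)].
Proof.
move=> sq; pose c2 : {mpoly R[3]} := (2^-1)%:MP.
pose v := (1 - cz) * c2.
have vF : v%:F = (1 - zF) / 2.
  by rewrite tofracM tofrac_natV tofracB tofrac1.
have v0 : v != 0.
  apply/eqP=> /(congr1 (meval (fun=> 0))) /eqP.
  rewrite mevalM mevalB mevalXU !mevalC !subr0 mul1r.
  by rewrite invr_eq0 pnatr_eq0.
have chiE : chi = cy%:F / v%:F :> RF by rewrite vF invf_div mulrA [cy%:F * _]mulrC.
have Pv : inP 1 v.
  rewrite -[1%N]addn0; apply: inPM (inPC _ _).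
  by apply: inPB (inP_nat 1 1) (inP_var _).
rewrite -vF chiE => Ep.
have [Pp [a [b [Pa Pb aF euler dp]]]] := homogenize_gradient sq v0 (inP_var _) Pv Ep.
split=> //; exists a, (c2 * b).
have gradp : grad p = vec3 0 a (- (c2 * b)).
  by apply: col3P; rewrite gradE vec3E dp !mderivE /=; ring.
split=> //; first by apply: (@inPM 0) (inPC _ _) Pb.
by rewrite euler gradp /dot /rvec !vec3E /v /cx /cy /cz; ring.
Qed.

(** The second affine form is the constant 1, whose gradient vanishes; [b] therefore enters only
    Euler's identity. *)
Lemma simplex_h_gradient n q p : (size q <= n.+2)%N ->
  p = (map_poly (@mpolyC 3 R) q).[cz] ->
  exists a b, [/\ inP n a, inP n b, a%:F = evalF q^`() zF,
    n.+1%:R * p = dot rvec (grad p) + b & grad p = vec3 0 0 a].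
Proof.
move=> sq Ep.
have Ep' : p%:F = evalF q (cz%:F / 1%:F) * 1%:F ^+ n.+1.
  rewrite tofrac1 divr1 expr1n mulr1 Ep /evalF -horner_map.
  by rewrite -map_poly_comp.
have [_ [a [b [Pa Pb aF euler dp]]]] :=
  homogenize_gradient sq (oner_neq0 _) (inP_var _) (inP_nat 1 1) Ep'.
have gradp : grad p = vec3 0 0 a.
  by apply: col3P; rewrite gradE vec3E dp !mderivE /=; ring.
exists a, b; split=> //.
  by rewrite aF tofrac1 divr1 expr1n mulr1.
by rewrite euler gradp /dot /rvec !vec3E /cz; ring.
Qed.

(** * Degree bounds for vector fields *)

Lemma inP3_vec3 n p p' p'' : inP n p -> inP n p' -> inP n p'' ->
  inP3 n (vec3 p p' p'').
Proof. by move=> Pp Pp' Pp''; apply: ord3_ind; rewrite !vec3E. Qed.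

Lemma inP3D n (u v : 'cV[{mpoly R[3]}]_3) : inP3 n u -> inP3 n v -> inP3 n (u + v).
Proof. by move=> Pu Pv i; rewrite colD; apply: inPD. Qed.

Lemma inP3N n (u : 'cV[{mpoly R[3]}]_3) : inP3 n u -> inP3 n (- u).
Proof. by move=> Pu i; rewrite colN; apply: inPN. Qed.

Lemma inP3Z m n p (u : 'cV[{mpoly R[3]}]_3) :
  inP m p -> inP3 n u -> inP3 (m + n) (p *: u).
Proof. by move=> Pp Pu i; rewrite colZ; apply: inPM. Qed.

Lemma inP3_cross m n (u v : 'cV[{mpoly R[3]}]_3) :
  inP3 m u -> inP3 n v -> inP3 (m + n) (cross u v).
Proof. by move=> Pu Pv; apply: inP3_vec3; apply: inPB; apply: inPM. Qed.

(** The index is a successor, where the predecessor in [inRT] is exact. *)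
Lemma inRT_decomposition m p (w u : 'cV[{mpoly R[3]}]_3) :
  inP m p -> inP3 m u -> w = p *: rvec + u -> inRT m.+1 w.
Proof. by move=> Pp Pu ->; exists p, u. Qed.

End Polynomials.

(** * Splitting w into a multiple of the position vector and a remainder *)

Section Decompositions.
Variable R : realFieldType.
Implicit Types (f g h : {mpoly R[3]}).

Lemma w_ge2_decomposition i j k f g h (a c d bf bg bh : {mpoly R[3]}) :
  i%:R * f = dot rvec (grad f) + bf -> grad f = vec3 a (- 2 * bf) (- bf) ->
  j%:R * g = dot rvec (grad g) + bg -> grad g = vec3 0 c (- bg) ->
  k%:R * h = dot rvec (grad h) + bh -> grad h = vec3 0 0 d ->
  w_ge2 i j k f g h = (a * c * d) *: rvec +
    (bf *: cross (grad g) (grad h) - bg *: cross (grad f) (grad h)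
     + bh *: cross (grad f) (grad g)).
Proof.
move=> Ef df Eg dg Eh dh.
(* The matrix with rows [grad f], [grad g], [grad h] is upper triangular with diagonal [a], [c],
   [d]. *)
have <- : dot (grad f) (cross (grad g) (grad h)) = a * c * d.
  by rewrite df dg dh /dot /cross !vec3E; ring.
rewrite -(dot_cross_decomposition rvec (grad f) (grad g) (grad h)).
rewrite /w_ge2 Ef Eg Eh.
(* With dot and cross products made opaque, only a regrouping of the Euler defects [bf], [bg], [bh]
   remains. *)
move: (cross (grad g) (grad h)) (cross (grad f) (grad h)) => u v.
move: (cross (grad f) (grad g)) => w.
move: (dot rvec (grad f)) (dot rvec (grad g)) (dot rvec (grad h)) => x y z.
by apply/matrixP=> s t; rewrite !mxE; ring.
Qed.

Lemma w_one_decomposition j k g h (c d bg bh : {mpoly R[3]}) :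
  j%:R * g = dot rvec (grad g) + bg -> grad g = vec3 0 c (- bg) ->
  k%:R * h = dot rvec (grad h) + bh -> grad h = vec3 0 0 d ->
  w_one j k g h =
    ((8^-1)%:MP * d * ((2 * cy + cz) * c + 4 * g)) *: rvec
    + (8^-1)%:MP *: vec3
        (cx * d * 2 * bg + bh * cx * (c + 2 * bg))
        (d * (2 * cy + cz) * bg - (j + 2)%:R * g * d - cz * d * bg - bh * bg
           + bh * bg * (2 * cy + cz) - 2 * g * bh)
        (4 * g * bh - cz * d * c - bh * c * (1 - 2 * cy - cz)).
Proof.
move=> Eg dg Eh dh.
have jg : j%:R * g = cy * c - cz * bg + bg.
  by rewrite Eg dg /dot /rvec !vec3E; ring.
have kh : k%:R * h = cz * d + bh by rewrite Eh dh /dot /rvec !vec3E; ring.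
have curlE : curl nedelec12 =
    (8^-1)%:MP *: vec3 0 2 (- 4) :> 'cV[{mpoly R[3]}]_3.
  rewrite /nedelec12 /cx /cy /cz !vec3Z /curl vec3_0 vec3_1 vec3_2 !mderivE /=.
  by congr vec3; ring.
(* The factor k always multiplies h and can be eliminated outright; j occurs as j + 2, so its Euler
   identity is passed on as the hypothesis [jg]. *)
have kgh : k%:R * g * h = (cz * d + bh) * g by rewrite -kh; ring.
rewrite /w_one kh kgh curlE dg dh natrD.
exact: w_one_cross_identity.
Qed.

End Decompositions.

(** The degree is left open and computed from the shape of the polynomial, with maxima for sums and
    additions for products; [lia] then compares it with the target. *)
Ltac inP_degree := apply: inP_leq; last first;
  [repeat first [eassumption | apply: inP_maxD | apply: inPN | apply: inPM
     | exact: inP_var | exact: (inPC 0) | refine (@inP_nat _ 0 _) | exact: (inP0 0)]|lia].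

(** * Membership in the Raviart-Thomas spaces *)

Theorem theorem4p1 (R : realFieldType)
    (qx : nat -> {poly R})
    (qy : nat -> nat -> {poly R})
    (qz : nat -> nat -> nat -> {poly R})
    (qx_deg : forall i, (2 <= i)%N -> exact_degree i (qx i))
    (qx_m1 : forall i, (2 <= i)%N -> (qx i).[-1] = 0)
    (qx_p1 : forall i, (2 <= i)%N -> (qx i).[1] = 0)
    (qx_D : forall i, (2 <= i)%N -> propD i (qx i))
    (qy_deg : forall i j, (1 <= i)%N -> (1 <= j)%N -> exact_degree j (qy i j))
    (qy_m1 : forall i j, (1 <= i)%N -> (1 <= j)%N -> (qy i j).[-1] = 0)
    (qy_D : forall i j, (1 <= i)%N -> (1 <= j)%N -> propD j (qy i j))
    (qz_deg : forall i j k, (1 <= i)%N -> (1 <= j)%N -> (1 <= k)%N ->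
      exact_degree k (qz i j k))
    (qz_m1 : forall i j k, (1 <= i)%N -> (1 <= j)%N -> (1 <= k)%N ->
      (qz i j k).[-1] = 0)
    (qz_D : forall i j k, (1 <= i)%N -> (1 <= j)%N -> (1 <= k)%N ->
      propD k (qz i j k))
    (f : nat -> {mpoly R[3]})
    (f_def : forall i, (2 <= i)%N -> (f i)%:F = f_rat qx i)
    (g : nat -> nat -> {mpoly R[3]})
    (g_def : forall i j, (1 <= i)%N -> (1 <= j)%N -> (g i j)%:F = g_rat qy i j) :
  (forall i j k : nat, (2 <= i)%N -> (1 <= j)%N -> (1 <= k)%N ->
     let w := w_ge2 i j k (f i) (g i j) (h_aux qz i j k) in
     inRT (i + j + k - 2) w /\
     exists (p1 : {mpoly R[3]}) (p2 : 'cV[{mpoly R[3]}]_3),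
       [/\ w = p1 *: rvec + p2,
           p1%:F = evalF (qx i)^`() eta * ((1 - 2 * yF - zF) / 4) ^+ (i - 1)
                   * evalF (qy i j)^`() chi * ((1 - zF) / 2) ^+ (j - 1)
                   * evalF (qz i j k)^`() zF,
           inP (i + j + k - 3) p1
         & inP3 (i + j + k - 3) p2])
  /\
  (forall j k : nat, (1 <= j)%N -> (1 <= k)%N ->
     let w := w_one j k (g 1%N j) (h_aux qz 1%N j k) in
     inRT (j + k) w /\
     exists (p1 : {mpoly R[3]}) (p2 : 'cV[{mpoly R[3]}]_3),
       [/\ w = p1 *: rvec + p2,
           p1%:F = ((1 - zF) / 2) ^+ (j - 1) * 8^-1 * evalF (qz 1%N j k)^`() zF
                   * ((2 * yF + zF) * evalF (qy 1%N j)^`() chi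
                      + 2 * (1 - zF) * evalF (qy 1%N j) chi),
           inP (j + k - 1) p1
         & inP3 (j + k - 1) p2]).
Proof.
have szqx i : size (qx i.+2) = i.+3 by apply: qx_deg.
have szqy i j : size (qy i.+1 j.+1) = j.+2 by apply: qy_deg.
have szqz i j k : size (qz i.+1 j.+1 k.+1) = k.+2 by apply: qz_deg.
(* Writing the indices as i + 2, j + 1, k + 1 makes i + 1, j, k the degree bounds of the derivatives
   and removes truncated subtractions. *)
split=> [[|[|i]] // [|j] // [|k] // _ _ _ w | [|j] // [|k] // _ _ w].
- have fE := f_def i.+2 isT; have gE := g_def i.+2 j.+1 isT isT.
  have [a [bf [Pa Pbf aF Ef df]]] := simplex_f_gradient (eq_leq (szqx i)) fE.
  have [_ [c [bg [Pc Pbg cF Eg dg]]]] := simplex_g_gradient (eq_leq (szqy _ j)) gE.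
  have [d [bh [Pd Pbh dF Eh dh]]] :=
    simplex_h_gradient (eq_leq (szqz i.+1 j k)) erefl.
  have := w_ge2_decomposition Ef df Eg dg Eh dh; rewrite -/w.
  set p2 := (_ *: cross _ _ - _ + _) => wE.
  have degE : (i.+2 + j.+1 + k.+1 - 3 = i.+1 + j + k)%N by lia.
  have Pacd : inP (i.+1 + j + k) (a * c * d) by apply: inPM (inPM _ _) _.
  have Pdf : inP3 i.+1 (grad (f i.+2)).
    by rewrite df; apply: inP3_vec3; inP_degree.
  have Pdg : inP3 j (grad (g i.+2 j.+1)).
    by rewrite dg; apply: inP3_vec3; inP_degree.
  have Pdh : inP3 k (grad (h_aux qz i.+2 j.+1 k.+1)).
    by rewrite dh; apply: inP3_vec3; inP_degree.
  (* Each summand multiplies the Euler defect of one function by the cross product of the other two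
     gradients, so each of the three degrees is counted once. *)
  have Pp2 : inP3 (i.+1 + j + k) p2.
    apply: inP3D; first apply: inP3D.
    + by rewrite -addnA; apply: inP3Z (inP3_cross _ _).
    + rewrite [(i.+1 + j)%N]addnC -addnA.
      by apply: inP3N; apply: inP3Z (inP3_cross _ _).
    + by rewrite addnC; apply: inP3Z (inP3_cross _ _).
  split; last first.
    exists (a * c * d), p2; rewrite degE; split=> //.
    by rewrite !tofracM aF cF dF !subn1 !mulrA.
  rewrite (_ : (_ - 2)%N = (i.+1 + j + k).+1); last by lia.
  exact: inRT_decomposition wE.
- have gE := g_def 1%N j.+1 isT isT.
  have [Pg [c [bg [Pc Pbg cF Eg dg]]]] := simplex_g_gradient (eq_leq (szqy _ j)) gE.
  have [d [bh [Pd Pbh dF Eh dh]]] :=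
    simplex_h_gradient (eq_leq (szqz 0%N j k)) erefl.
  have := w_one_decomposition Eg dg Eh dh; rewrite -/w.
  set p1 := (X in X *: rvec); set p2 := (X in _ + X) => wE.
  have degE : (j.+1 + k.+1 - 1 = (j + k).+1)%N by lia.
  have Pp1 : inP (j + k).+1 p1 by rewrite /p1 /cy /cz; inP_degree.
  (* The bound on [g j] is one above those on [c] and [bg], but in [p2] it multiplies only [d] or
     [bh], without a coordinate factor. *)
  have Pp2 : inP3 (j + k).+1 p2.
    rewrite /p2 -[(j + k).+1]add0n; apply: inP3Z; first exact: inPC.
    by apply: inP3_vec3; rewrite /cx /cy /cz; inP_degree.
  split; last first.
    exists p1, p2; rewrite degE; split=> //.
    rewrite /p1 !tofracM tofracD !tofracM tofracD tofracM tofrac_natV !rmorph_nat dF cF gE /g_rat.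
    rewrite subn1 /= exprS -/yF -/zF.
    (* One factor (1 - z)/2 split off the power in g turns the coefficient 4 of [p1] into the stated
       2 (1 - z). *)
    have <- : 4 * ((1 - zF) / 2) = 2 * (1 - zF) :> {fraction {mpoly R[3]}}.
      by rewrite (natrM _ 2 2) -mulrA [2 * (_ / _)]mulrC divfK // fraction_nat_neq0.
    by move: (evalF _ chi) (evalF _ chi) (evalF _ zF) ((1 - zF) / 2) => *; ring.
  rewrite (_ : (j.+1 + k.+1)%N = (j + k).+2); last by lia.
  exact: inRT_decomposition wE.
Qed.
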